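(* Let $\Gamma$ be a graph, and let $e$ be a regular edge of $\Gamma$ that has parallel edges in $\Gamma$. Then both of the following conditions hold: (I) $\Psi_{\Gamma/e}\in(\partial\Psi_{\Gamma\smallsetminus e})$, the ideal of $k[t_f: f\neq e]$ generated by the partial derivatives of $\Psi_{\Gamma\smallsetminus e}$; (II) for every point $q\in E\cap\partial\widetilde X_\Gamma$, if $I$ is the ideal of $\partial\widetilde X_\Gamma$ in the local ring $\mathcal O_{\widetilde X_\Gamma,q}$ and $u$ is a local equation of $E$ at $q$, then $u$ is a non-zero-divisor modulo $I^j$ for all $j\gg 0$.
   Context: Work over an algebraically closed field $k$ of characteristic $0$. Graphs are finite; looping edges and parallel edges are allowed, and graphs need not be connected. To each edge $f$ of a graph $\Gamma$ associate a variable $t_f$. The graph polynomial is $\Psi_\Gamma=\sum_T\prod_{f\notin T}t_f$, where $T$ ranges over the maximal spanning forests of $\Gamma$. If $\Gamma$ has $n$ edges, $X_\Gamma\subseteq\mathbb P^{n-1}$ is the hypersurface $\Psi_\Gamma=0$. $\Gamma\smallsetminus e$ and $\Gamma/e$ are the graphs obtained by deleting, resp. contracting, the edge $e$. An edge $e$ is regular if it is neither a bridge nor a looping edge and $\Gamma\smallsetminus e$ is not a forest. For a regular edge $e$ one has $\Psi_\Gamma=t_e\Psi_{\Gamma\smallsetminus e}+\Psi_{\Gamma/e}$, and the point $p\in\mathbb P^{n-1}$ at which all coordinates except $t_e$ vanish lies on $X_\Gamma$. Let $\widetilde{\mathbb P}^{n-1}$ be the blow-up of $\mathbb P^{n-1}$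 at $p$, with exceptional divisor $D$; let $\widetilde X_\Gamma$ be the blow-up of $X_\Gamma$ at $p$, realized as the proper transform of $X_\Gamma$, a hypersurface in $\widetilde{\mathbb P}^{n-1}$; and let $E=D\cap\widetilde X_\Gamma$ be its exceptional divisor. For a hypersurface $Y$ in a nonsingular variety, $\partial Y$ denotes its singularity subscheme, locally defined by the ideal generated by a local equation of $Y$ and its partial derivatives. *)

(* Defs.v *)
From HB Require Import structures.
From mathcomp Require Import all_boot all_order all_algebra ring.
From mathcomp Require Import generic_quotient ring_quotient.
From mathcomp Require Import boolp.
From mathcomp Require Export mpoly.

Set Implicit Arguments.
Unset Strict Implicit.
Unset Printing Implicit Defensive.

Import GRing.Theory.

Local Open Scope ring_scope.
Local Open Scope quotient_scope.

(* The edges of a graph with n edges are indexed by 'I_n; each edge has an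
   (arbitrarily ordered) pair of endpoints, so that looping edges, parallel
   edges and disconnected graphs are all allowed. *)
Record graph (n : nat) := Graph {
  vertex : finType;
  ends : 'I_n -> vertex * vertex
}.

Section Graphs.
Variables (n : nat) (G : graph n).

Definition looping (f : 'I_n) : bool := (ends G f).1 == (ends G f).2.

Definition parallel (f g : 'I_n) : bool :=
  (ends G f == ends G g) || (ends G f == ((ends G g).2, (ends G g).1)).

Definition adjacent : rel (vertex G) := fun x y =>
  [exists f : 'I_n, (ends G f == (x, y)) || (ends G f == (y, x))].

Definition ncomponents : nat := n_comp adjacent predT.

(* A dart (f, b) is the edge f traversed from its first to its second endpoint
   if b = false, and in the opposite direction if b = true. *)
Definition dart_src (d : 'I_n * bool) : vertex G :=
  if d.2 then (ends G d.1).2 else (ends G d.1).1.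
Definition dart_tgt (d : 'I_n * bool) : vertex G :=
  if d.2 then (ends G d.1).1 else (ends G d.1).2.

(* A looping edge is a cycle of length 1, and a pair of distinct non-looping
   parallel edges is a cycle of length 2. *)
Definition graph_cycle (ds : seq ('I_n * bool)) : bool :=
  [&& ds != [::],
      cycle (fun d d' => dart_tgt d == dart_src d') ds,
      uniq [seq dart_src d | d <- ds]
    & uniq [seq d.1 | d <- ds]].

(* A set of edges stands for the spanning subgraph (all the vertices of G) with
   these edges. *)
Definition is_forest (T : {set 'I_n}) : bool :=
  `[< ~ exists2 ds, graph_cycle ds & {subset [seq d.1 | d <- ds] <= T} >].

Definition max_forest (T : {set 'I_n}) : bool := maxset is_forest T.

End Graphs.

Definition graph_poly (k : comNzRingType) (n : nat) (G : graph n) :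
    {mpoly k[n]} :=
  \sum_(T : {set 'I_n} | max_forest G T) \prod_(f | f \notin T) 'X_f.

(* The edges f != e of a graph with m.+1 edges are indexed by 'I_m through
   [lift e]; accordingly {mpoly k[m]} is the polynomial ring k[t_f : f != e]. *)
Section DeletionContraction.
Variables (m : nat) (G : graph m.+1) (e : 'I_m.+1).

Definition deletion : graph m := Graph (fun f => ends G (lift e f)).

(* The retraction of the vertices identifying the endpoints of e. *)
Definition merge_ends (v : vertex G) : vertex G :=
  if v == (ends G e).2 then (ends G e).1 else v.

Definition contracted_vertex : finType :=
  {v : vertex G | v \in codom merge_ends}.

Definition to_contracted (v : vertex G) : contracted_vertex :=
  exist _ (merge_ends v) (codom_f merge_ends v).

Definition contraction : graph m :=
  Graph (fun f => (to_contracted (ends G (lift e f)).1,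
                   to_contracted (ends G (lift e f)).2)).

Definition bridge : bool := (ncomponents G < ncomponents deletion)%N.

Definition regular_edge : bool :=
  [&& ~~ bridge, ~~ looping G e & ~~ is_forest deletion setT].

End DeletionContraction.

Section Ideals.
Variable A : comPzRingType.

Definition ideal_gen (S : A -> Prop) : A -> Prop := fun x =>
  exists (r : nat) (c g : 'I_r -> A),
    (forall i, S (g i)) /\ x = \sum_(i < r) c i * g i.

(* The power with exponent 0 is the unit ideal. *)
Definition ideal_pow (I : A -> Prop) (j : nat) : A -> Prop :=
  ideal_gen (fun x => exists g : 'I_j -> A,
    (forall i, I (g i)) /\ x = \prod_(i < j) g i).

Definition nonzerodivisor_mod (I : A -> Prop) (v : A) : Prop :=
  forall h, I (v * h) -> I h.

End Ideals.

(* The local ring at the prime q of the subscheme F = 0 of Spec R, that is the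
   localization of R / (F) at (the image of) q: fractions a / b with b not in
   q, where a / b = c / d iff s * (a * d - c * b) is a multiple of F for some s
   not in q. *)
Section LocalRing.
Variables (R : comNzRingType) (F : R) (q : prime_idealr R).

Definition fracs : choiceType := {x : R * R | x.2 \notin (q : pred R)}.

Definition frac_eqv (x y : fracs) : bool :=
  `[< exists s c : R, s \notin (q : pred R) /\
      s * ((val x).1 * (val y).2 - (val y).1 * (val x).2) = F * c >].

Fact notin_primeM (a b : R) :
  a \notin (q : pred R) -> b \notin (q : pred R) -> a * b \notin (q : pred R).
Proof. by move=> qa qb; rewrite prime_idealrM negb_or qa. Qed.

Fact notin_prime1 : 1 \notin (q : pred R).
Proof. by rewrite idealr1. Qed.

Fact frac_eqv_equiv : equiv_class_of frac_eqv.
Proof.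
split=> [x|x y|y x z].
- apply/asboolP; exists 1, 0; split; first exact: notin_prime1.
  by rewrite subrr !mulr0.
- by apply/asboolP/asboolP=> -[s [c [qs Es]]]; exists s, (- c); split=> //;
    rewrite mulrN -Es; ring.
- move=> /asboolP[s [c [qs Es]]] /asboolP[t [d [qt Et]]]; apply/asboolP.
  exists (s * t * (val y).2), (t * (val z).2 * c + s * (val x).2 * d); split.
    by do 2?apply: notin_primeM => //; exact: (valP y).
  rewrite mulrDr [RHS](_ : _ = t * (val z).2 * (F * c) + s * (val x).2 * (F * d)).
    by rewrite -Es -Et; ring.
  by ring.
Qed.

Canonical frac_eqv_canonical := EquivRelPack frac_eqv_equiv.
Canonical frac_eqv_encModRel := defaultEncModRel frac_eqv.

Definition local_ring := {eq_quot frac_eqv}.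
HB.instance Definition _ : EqQuotient fracs frac_eqv local_ring :=
  EqQuotient.on local_ring.
HB.instance Definition _ := Choice.on local_ring.

Definition frac (a b : R) (qb : b \notin (q : pred R)) : fracs :=
  exist _ (a, b) qb.

Definition frac_int (a : R) : fracs := frac a notin_prime1.
Definition frac_add (x y : fracs) : fracs :=
  frac ((val x).1 * (val y).2 + (val y).1 * (val x).2)
       (notin_primeM (valP x) (valP y)).
Definition frac_opp (x : fracs) : fracs := frac (- (val x).1) (valP x).
Definition frac_mul (x y : fracs) : fracs :=
  frac ((val x).1 * (val y).1) (notin_primeM (valP x) (valP y)).

Definition germ (a : R) : local_ring := \pi_local_ring (frac_int a).
Definition loc_add := lift_op2 local_ring frac_add.
Definition loc_opp := lift_op1 local_ring frac_opp.
Definition loc_mul := lift_op2 local_ring frac_mul.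

Fact frac_eqvP (x y : fracs) :
  reflect (exists s c : R, s \notin (q : pred R) /\
      s * ((val x).1 * (val y).2 - (val y).1 * (val x).2) = F * c)
    (\pi_local_ring x == \pi_local_ring y).
Proof. by rewrite piE; exact: asboolP. Qed.

Fact repr_frac (x : fracs) : exists s c : R, s \notin (q : pred R) /\
  s * ((val (repr (\pi_local_ring x))).1 * (val x).2
       - (val x).1 * (val (repr (\pi_local_ring x))).2) = F * c.
Proof. by apply/frac_eqvP; rewrite reprK. Qed.

Fact pi_loc_add : {morph \pi : x y / frac_add x y >-> loc_add x y}.
Proof.
move=> x y; unlock loc_add; apply/eqP; rewrite eq_sym; apply/frac_eqvP => /=.
have [s [c [qs Es]]] := repr_frac x; have [t [d [qt Et]]] := repr_frac y.
set x' := val (repr (\pi x)) in Es *; set y' := val (repr (\pi y)) in Et *.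
exists (s * t), (t * y'.2 * (val y).2 * c + s * x'.2 * (val x).2 * d).
split; first exact: notin_primeM.
rewrite [RHS](_ : _ = t * y'.2 * (val y).2 * (F * c)
                      + s * x'.2 * (val x).2 * (F * d)); last by ring.
by rewrite -Es -Et; ring.
Qed.

Fact pi_loc_opp : {morph \pi : x / frac_opp x >-> loc_opp x}.
Proof.
move=> x; unlock loc_opp; apply/eqP; rewrite eq_sym; apply/frac_eqvP => /=.
have [s [c [qs Es]]] := repr_frac x.
by exists s, (- c); split=> //; rewrite mulrN -Es; ring.
Qed.

Fact pi_loc_mul : {morph \pi : x y / frac_mul x y >-> loc_mul x y}.
Proof.
move=> x y; unlock loc_mul; apply/eqP; rewrite eq_sym; apply/frac_eqvP => /=.
have [s [c [qs Es]]] := repr_frac x; have [t [d [qt Et]]] := repr_frac y.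
set x' := val (repr (\pi x)) in Es *; set y' := val (repr (\pi y)) in Et *.
exists (s * t), (t * y'.1 * (val y).2 * c + s * x'.2 * (val x).1 * d).
split; first exact: notin_primeM.
rewrite [RHS](_ : _ = t * y'.1 * (val y).2 * (F * c)
                      + s * x'.2 * (val x).1 * (F * d)); last by ring.
by rewrite -Es -Et; ring.
Qed.

Fact frac_eq (x y : fracs) :
  (val x).1 * (val y).2 = (val y).1 * (val x).2 ->
  \pi_local_ring x = \pi_local_ring y.
Proof.
move=> xy; apply/eqP/frac_eqvP; exists 1, 0; split; first exact: notin_prime1.
by rewrite xy subrr !mulr0.
Qed.

Fact loc_addA : associative loc_add.
Proof.
move=> x y z; rewrite -[x]reprK -[y]reprK -[z]reprK -!pi_loc_add.
by apply: frac_eq => /=; ring.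
Qed.

Fact loc_addC : commutative loc_add.
Proof.
move=> x y; rewrite -[x]reprK -[y]reprK -!pi_loc_add.
by apply: frac_eq => /=; ring.
Qed.

Fact loc_add0 : left_id (germ 0) loc_add.
Proof.
move=> x; rewrite -[x]reprK -pi_loc_add.
by apply: frac_eq => /=; ring.
Qed.

Fact loc_addN : left_inverse (germ 0) loc_opp loc_add.
Proof.
move=> x; rewrite -[x]reprK -pi_loc_opp -pi_loc_add.
by apply: frac_eq => /=; ring.
Qed.

HB.instance Definition _ :=
  GRing.isZmodule.Build local_ring loc_addA loc_addC loc_add0 loc_addN.

Fact loc_mulA : associative loc_mul.
Proof.
move=> x y z; rewrite -[x]reprK -[y]reprK -[z]reprK -!pi_loc_mul.
by apply: frac_eq => /=; ring.
Qed.

Fact loc_mulC : commutative loc_mul.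
Proof.
move=> x y; rewrite -[x]reprK -[y]reprK -!pi_loc_mul.
by apply: frac_eq => /=; ring.
Qed.

Fact loc_mul1 : left_id (germ 1) loc_mul.
Proof.
move=> x; rewrite -[x]reprK -pi_loc_mul.
by apply: frac_eq => /=; ring.
Qed.

Fact loc_mulDl : left_distributive loc_mul loc_add.
Proof.
move=> x y z; rewrite -[x]reprK -[y]reprK -[z]reprK.
rewrite -!pi_loc_mul -!pi_loc_add -pi_loc_mul.
by apply: frac_eq => /=; ring.
Qed.

HB.instance Definition _ := GRing.Zmodule_isComPzRing.Build local_ring
  loc_mulA loc_mulC loc_mul1 loc_mulDl.

Fact germ_is_zmod_morphism : zmod_morphism germ.
Proof.
move=> a b; rewrite /germ /GRing.add /GRing.opp /= -pi_loc_opp -pi_loc_add.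
by apply: frac_eq => /=; rewrite !mulr1.
Qed.

Fact germ_is_monoid_morphism : monoid_morphism germ.
Proof.
split=> // a b; rewrite /germ /GRing.mul /= -pi_loc_mul.
by apply: frac_eq => /=; rewrite !mulr1.
Qed.

HB.instance Definition _ :=
  GRing.isZmodMorphism.Build R local_ring germ germ_is_zmod_morphism.
HB.instance Definition _ :=
  GRing.isMonoidMorphism.Build R local_ring germ germ_is_monoid_morphism.

(* The next three facts characterize [germ] as the localization map. *)
Lemma germ_eq0 (a : R) :
  germ a = 0 <-> exists s c : R, s \notin (q : pred R) /\ s * a = F * c.
Proof.
rewrite -[0]/(germ 0) /germ; split=> [/eqP/frac_eqvP|] [s [c [qs Es]]].
  by exists s, c; split=> //; rewrite -Es /= mulr1 mul0r subr0.
by apply/eqP/frac_eqvP; exists s, c; split=> //=; rewrite mulr1 mul0r subr0.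
Qed.

Lemma germ_invertible (s : R) :
  s \notin (q : pred R) -> exists x : local_ring, germ s * x = 1.
Proof.
move=> qs; exists (\pi_local_ring (frac 1 qs)).
rewrite -[1 in RHS]/(germ 1) /germ /GRing.mul /= -pi_loc_mul.
by apply: frac_eq => /=; ring.
Qed.

Lemma germ_frac (x : local_ring) :
  exists a s : R, s \notin (q : pred R) /\ germ s * x = germ a.
Proof.
rewrite -[x]reprK; case: (repr x) => -[a s] qs; exists a, s; split=> //.
rewrite /germ /GRing.mul /= -pi_loc_mul.
by apply: frac_eq => /=; ring.
Qed.

End LocalRing.

(* Let p be the point of P^m at which all coordinates except t_e vanish. The
   part of the blow-up of P^m at p lying over the affine chart t_e = 1, hence a
   neighbourhood of the exceptional divisor D, is covered by the affine spaces
   A^m indexed by i : 'I_m. The i-th one has coordinates u = 'X_i and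
   s_j = 'X_j (j != i); the blow-down map is given by t_e = 1,
   t_(lift e i) = u, t_(lift e j) = u * s_j, and D has equation u = 0. *)
Section BlowUp.
Variables (k : fieldType) (m : nat) (e : 'I_m.+1) (i : 'I_m).

Definition blowdown : m.+1.-tuple {mpoly k[m]} :=
  [tuple if unlift e f is Some j
         then if j == i then 'X_i else 'X_i * 'X_j
         else 1 | f < m.+1].

(* F is an equation, in the i-th chart, of the proper transform of the
   hypersurface P = 0: it generates the ideal of the scheme-theoretic closure
   of the inverse image of {P = 0} minus p, which is the saturation with respect
   to u of the ideal generated by the pull-back of P. *)
Definition proper_transform_eq (P : {mpoly k[m.+1]}) (F : {mpoly k[m]}) : Prop :=
  forall g : {mpoly k[m]},
    (exists c, g = F * c) <->
    (exists r c, 'X_i ^+ r * g = (P \mPo blowdown) * c).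

End BlowUp.

(* Generators of the ideal of the singularity subscheme of F = 0 in A^m. *)
Definition sing_gens (k : fieldType) (m : nat) (F : {mpoly k[m]}) :
    {mpoly k[m]} -> Prop :=
  fun g => g = F \/ exists j : 'I_m, g = F^`M(j).

Definition sing_local_ideal (k : fieldType) (m : nat) (F : {mpoly k[m]})
    (q : prime_idealr {mpoly k[m]}) : local_ring F q -> Prop :=
  ideal_gen (fun x => exists2 g, sing_gens F g & x = germ F q g).

(* v is a local equation at q of the subscheme of F = 0 cut out by w = 0. *)
Definition local_equation (k : fieldType) (m : nat) (F w : {mpoly k[m]})
    (q : prime_idealr {mpoly k[m]}) (v : local_ring F q) : Prop :=
  forall x, ideal_gen (eq v) x <-> ideal_gen (eq (germ F q w)) x.

(* Main.v *)
Require Import Defs.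
From mathcomp Require Import all_boot all_order all_algebra.
From mathcomp Require Import ring_quotient.
From HB Require Import structures.
From mathcomp Require Import perm ring boolp.

(** Write P for the polynomial of the deletion of e, Q for that of the
    contraction of e, and let f be an edge parallel to e.

    Exchanging the parallel edges e and f turns maximal forests into maximal
    forests. Hence those of the contraction are the T minus f, where T runs over
    the maximal forests of the deletion that contain f, and
    Q = t_f B, where B = P - t_f dP/dt_f collects the terms of P that do not
    involve t_f ([contraction_polyE]). All maximal forests have the same number
    of edges, namely the rank of the incidence matrix, so that P is homogeneous,
    of positive degree d since the deletion is not a forest. By Euler's formula
    and characteristic 0, P, hence also Q, is a combination of the partial
    derivatives of P: this is (I).

    For (II), if P = t_f A + B then Psi = t_e t_f A + (t_e + t_f) B is, up to
    the factor t_e + t_f, a function of the parallel resistance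
    t_e t_f / (t_e + t_f) and of the other variables. So the hypersurface is
    preserved by a flow that changes t_e and t_f but not 1/t_e + 1/t_f. By
    homogeneity its generator - t_e^2 d/dt_e + t_f^2 d/dt_f becomes, in the
    coordinates t_e = 1, the field V = Euler + t_f^2 d/dt_f, and
    V (P + Q) = (d + t_f)(P + Q) ([flow_deletion_contraction]). In the chart
    with exceptional divisor u = 0, V is u times a polynomial vector field D
    with D u = 1 modulo u ([chart_field_comp]). Thus D is transverse to the
    exceptional divisor and tangent to the proper transform F = 0: near the
    exceptional divisor the proper transform is a product with a line, and so is
    its singularity subscheme.

    The flow of D is not given by polynomials, and the product structure is
    exploited infinitesimally instead. Since D F is a multiple of F, the ideal J
    of the singularity subscheme and all the ideals K = J^j + (F) are stable
    under D ([pow_plus_stable]). Assume u h lies in K. For a suitable polynomial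
    r the operator E = D - r acts on a finite-dimensional space containing h,
    and h is killed by a product of operators E - lambda with lambda constant
    ([chart_triangularizable_eq], [chart_triangularizable_neq]). Applying E to
    u^d h in K lowers the exponent of u, and an induction on the number of
    factors gives h in K ([triangularizable_cancel]). So u is a
    non-zero-divisor modulo J^j + (F) in the polynomial ring, for every j, and
    this passes to the local rings ([nonzerodivisor_localize]). *)

Set Implicit Arguments.
Unset Strict Implicit.
Unset Printing Implicit Defensive.

Import GRing.Theory.
Local Open Scope ring_scope.

(** * Forests, cuts and incidence vectors *)

Section Forests.
Variables (n : nat) (G : graph n).
Implicit Types (T : {set 'I_n}) (f g : 'I_n) (ds : seq ('I_n * bool)).

Definition separates (chi : vertex G -> bool) f : bool :=
  chi (ends G f).1 != chi (ends G f).2.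

(** The bond form of acyclicity: each edge g of T is the only edge of T that
    crosses some bipartition of the vertices. It is easy to transport along
    operations on graphs, unlike the cycles. *)
Definition every_edge_cuts T : Prop :=
  forall g, g \in T -> exists chi, separates chi g /\
    forall f, f \in T -> f != g -> ~~ separates chi f.

(** Linear independence of the incidence vectors of T, in dual form: a relation
    is tested against all the functions on vertices, so that relations pull back
    along maps of vertices without any quotient. *)
Definition edge_independent T : Prop :=
  forall c : 'I_n -> rat,
    (forall chi : vertex G -> rat,
       \sum_(f in T) c f * (chi (ends G f).1 - chi (ends G f).2) = 0) ->
    forall f, f \in T -> c f = 0.

Lemma dart_pathE (d : 'I_n * bool) ds :
  path (fun d d' => dart_tgt G d == dart_src G d') d ds =
  (map (dart_tgt G) (belast d ds) == map (dart_src G) ds).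
Proof. by elim: ds d => //= d' ds IH d; rewrite eqseq_cons IH. Qed.

Lemma dart_cycleE ds :
  cycle (fun d d' => dart_tgt G d == dart_src G d') ds =
  (map (dart_tgt G) ds == rot 1 (map (dart_src G) ds)).
Proof.
case: ds => [|d ds] //.
by rewrite /cycle dart_pathE belast_rcons map_rcons /= rot1_cons.
Qed.

(** On a path without repeated vertices no edge is used twice: the second use
    would return to the source of the first. *)
Lemma path_darts (e : rel (vertex G)) (S : pred 'I_n) x p :
  (forall y z, e y z ->
     exists d, [/\ S d.1, dart_src G d = y & dart_tgt G d = z]) ->
  path e x p -> uniq (x :: p) ->
  exists ds, [/\ map (dart_src G) ds = belast x p, map (dart_tgt G) ds = p,
                 all (fun d => S d.1) ds & uniq (map fst ds)].
Proof.
move=> eP; elim: p x => [|y p IH] x /=; first by exists [::].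
move=> /andP[/eP[d [Sd dx dy]] yp] /andP[xp up].
have [ds [srcE tgtE Sds uds]] := IH y yp up; exists (d :: ds).
split=> //=; rewrite ?dx ?dy ?srcE ?tgtE ?Sd //= uds andbT.
apply/mapP => -[d' d'ds dd'].
have srcd' : dart_src G d' \in y :: p.
  by apply: mem_belast; rewrite -srcE map_f.
have tgtd' : dart_tgt G d' \in y :: p.
  by rewrite inE -[in _ \in p]tgtE map_f ?orbT.
have : (x == dart_src G d') || (x == dart_tgt G d').
  rewrite -dx /dart_src /dart_tgt dd'.
  by case: (d.2); case: (d'.2); rewrite eqxx ?orbT.
by case/orP => /eqP xE; rewrite xE ?srcd' ?tgtd' in xp.
Qed.

(** The cut for g separates the component of one end of g in T minus g from the
    rest: if the other end were in it, then a simple path joining the two ends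
    would close up with g into a cycle. *)
Lemma forest_cuts T : is_forest G T -> every_edge_cuts T.
Proof.
move=> /asboolP acyc g gT.
pose e x y := [exists f in T :\ g,
  (ends G f == (x, y)) || (ends G f == (y, x))].
have e_edge f : f \in T -> f != g ->
    e (ends G f).1 (ends G f).2 /\ e (ends G f).2 (ends G f).1.
  move=> fT fg; split; apply/exists_inP; exists f; rewrite ?inE ?fg //;
  by case: (ends G f) => a b; rewrite eqxx ?orbT.
exists (connect e (ends G g).1); split; last first.
  move=> f fT fg; have [e12 e21] := e_edge f fT fg; rewrite negbK.
  apply/eqP; apply/idP/idP => c; apply: connect_trans c _; exact: connect1.
rewrite /separates connect0 eq_sym eqb_id.
apply/negP => /connectP[p0 ep0 tE]; apply: acyc.
move: tE; case/shortenP: ep0 => p ep up _ tE.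
have eP y z : e y z -> exists d : 'I_n * bool,
    [/\ d.1 \in T :\ g, dart_src G d = y & dart_tgt G d = z].
  case/exists_inP => f fTg /orP[] /eqP fE;
    [exists (f, false) | exists (f, true)];
    by rewrite /dart_src /dart_tgt /= fE.
have [ds [srcE tgtE /allP Sds uds]] := path_darts (S := [in T :\ g]) eP ep up.
exists ((g, true) :: ds); last first.
  move=> f /mapP[d /predU1P[-> -> //|/Sds dT ->]].
  by case/setD1P: dT.
apply/and4P; split=> //.
- rewrite dart_cycleE /= rot1_cons srcE tgtE [dart_src G _]tE -lastI.
  exact: eqxx.
- rewrite /= srcE [dart_src G _]tE -rcons_uniq -lastI; exact: up.
- rewrite /= uds andbT; apply/mapP => -[d /Sds dT gE].
  by rewrite -gE !inE eqxx in dT.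
Qed.

(** Testing a relation against the indicator function of a cut only leaves the
    term of the edge that crosses it. *)
Lemma cuts_independent T : every_edge_cuts T -> edge_independent T.
Proof.
move=> cut c c0 g gT; have [chi [chig chif]] := cut g gT.
have := c0 (fun x => (chi x)%:R); rewrite (bigD1 g) //= big1 ?addr0.
  move=> /eqP; rewrite mulf_eq0 => /predU1P[//|].
  by move: chig; rewrite /separates; do 2!case: (chi _).
move=> f /andP[fT fg]; have := chif f fT fg; rewrite negbK => /eqP->.
by rewrite subrr mulr0.
Qed.

(** The signed sum of the incidence vectors along a cycle telescopes to 0, and
    its coefficients are 1 and -1 as the edges of a cycle are distinct. *)
Lemma independent_forest T : edge_independent T -> is_forest G T.
Proof.
move=> indep; apply/asboolP => -[ds /and4P[ds0 cyc _ uds] dsT].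
rewrite dart_cycleE in cyc.
pose sgn (d : 'I_n * bool) : rat := if d.2 then -1 else 1.
pose c f := \sum_(d <- ds | d.1 == f) sgn d.
have c0 chi : \sum_(f in T) c f * (chi (ends G f).1 - chi (ends G f).2) = 0.
  transitivity (\sum_(d <- ds) (chi (dart_src G d) - chi (dart_tgt G d))).
    rewrite [RHS]big_seq.
    rewrite [RHS](partition_big (fun d : 'I_n * bool => d.1) (mem T)) /=;
      last by move=> d dds; apply: dsT; apply: map_f.
    apply: eq_bigr => f fT; rewrite /c big_seq_cond mulr_suml; apply: eq_bigr.
    move=> d /andP[_ /eqP <-]; rewrite /sgn /dart_src /dart_tgt.
    by case: (d.2); rewrite ?mulN1r ?mul1r ?opprB.
  rewrite sumrB -[X in X - _](big_map (dart_src G) predT) /=.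
  rewrite -[X in _ - X](big_map (dart_tgt G) predT) (eqP cyc).
  rewrite [X in _ - X](perm_big [seq dart_src G d | d <- ds]) ?subrr //=.
  by rewrite perm_rot.
case: ds ds0 uds dsT {cyc} @c c0 => [//|d ds] _ /= /andP[dds _] dsT c0.
have := indep _ c0 d.1 (dsT _ (mem_head _ _)).
rewrite big_cons eqxx big_seq_cond big1 ?addr0.
  by rewrite /sgn; case: (d.2).
by move=> d' /andP[d'ds /eqP d'E]; rewrite -d'E map_f in dds.
Qed.

Lemma forestP T : is_forest G T <-> every_edge_cuts T.
Proof.
split=> [/forest_cuts //|cut].
exact/independent_forest/cuts_independent.
Qed.

Lemma forest_independentP T : is_forest G T <-> edge_independent T.
Proof.
split=> [/forest_cuts/cuts_independent //|].
exact: independent_forest.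
Qed.

Lemma forest_sub (S T : {set 'I_n}) :
  S \subset T -> is_forest G T -> is_forest G S.
Proof.
move=> /subsetP ST /forestP cut; apply/forestP => g /ST gT.
have [chi [chig chif]] := cut g gT.
by exists chi; split=> // f /ST; apply: chif.
Qed.

Lemma max_forestP T :
  max_forest G T <->
  is_forest G T /\ forall g, g \notin T -> ~ is_forest G (g |: T).
Proof.
rewrite /max_forest; split.
  case/maxsetP => forT maxT; split=> // g gT forgT.
  by move: gT; rewrite -(maxT _ forgT (subsetUr _ _)) setU11.
move=> [forT maxT]; apply/maxsetP; split=> // B forB TB.
apply/eqP; rewrite eqEsubset TB andbT; apply/subsetP => g gB.
apply/negPn/negP => gT; apply: (maxT g gT); apply: forest_sub forB.
by rewrite subUset sub1set gB.
Qed.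

Definition incidence f : {ffun vertex G -> rat^o} :=
  [ffun x => (x == (ends G f).1)%:R - (x == (ends G f).2)%:R].

Lemma sum_incidence (chi : vertex G -> rat) f :
  \sum_x chi x * incidence f x = chi (ends G f).1 - chi (ends G f).2.
Proof.
have pick y : \sum_x chi x * (x == y)%:R = chi y.
  rewrite (bigD1 y) //= eqxx mulr1 big1 ?addr0 // => x /negbTE->.
  by rewrite mulr0.
by rewrite -!pick -sumrB; apply: eq_bigr => x _; rewrite ffunE mulrBr.
Qed.

Lemma forest_free T :
  is_forest G T <-> free [seq incidence f | f <- enum T].
Proof.
have sz : size [seq incidence f | f <- enum T] == #|T|.
  by rewrite size_map -cardE.
rewrite -[map _ _]/(val (Tuple sz)).
have entry (i : 'I_#|T|) : (Tuple sz)`_i = incidence (enum_val i).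
  rewrite /= (nth_map (enum_val i)) -?cardE //; by rewrite -enum_val_nth.
split=> [/forest_independentP indep|/freeP fr]; last first.
  (* a coordinate of a vector relation is its test on a delta function *)
  apply/forest_independentP => c c0 f fT.
  have := fr (fun i => c (enum_val i)) _ (enum_rank_in fT f).
  rewrite enum_rankK_in //; apply; apply/ffunP => x.
  rewrite sum_ffunE ffunE -[RHS](c0 (fun y => (y == x)%:R)).
  rewrite [RHS]big_enum_val /=.
  apply: eq_bigr => i _; rewrite entry !ffunE.
  by rewrite ![x == _]eq_sym.
apply/freeP => c c0 i.
have := indep (fun f => \sum_(j | enum_val j == f) c j) _ _ (enum_valP i).
rewrite (big_pred1 i); last by move=> j /=; rewrite (inj_eq enum_val_inj).
apply=> chi; rewrite big_enum_val /=.
transitivity (\sum_x chi x * (\sum_(j < #|T|) c j *: (Tuple sz)`_j) x).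
  under [RHS]eq_bigr do rewrite sum_ffunE mulr_sumr.
  rewrite exchange_big; apply: eq_bigr => j _ /=.
  rewrite (big_pred1 j); last by move=> l /=; rewrite (inj_eq enum_val_inj).
  rewrite -sum_incidence mulr_sumr; apply: eq_bigr => x _.
  by rewrite mulrCA entry [in RHS]ffunE.
by rewrite c0; apply: big1 => x _; rewrite ffunE mulr0.
Qed.

(** The maximal forests are the bases of the linear matroid of the incidence
    vectors, so they have the same number of edges. *)
Lemma card_max_forest T : max_forest G T ->
  #|T| = \dim <<[seq incidence f | f <- enum 'I_n]>>%VS.
Proof.
case/max_forestP => /forest_free frT maxT.
have <- : <<[seq incidence f | f <- enum T]>>%VS
          = <<[seq incidence f | f <- enum 'I_n]>>%VS.
  apply/eqP; rewrite eqEsubv; apply/andP; split; apply/span_subvP => v.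
    by case/mapP => f _ ->; rewrite memv_span // map_f // mem_enum.
  case/mapP => g _ ->; have [gT|gT] := boolP (g \in T).
    by rewrite memv_span // map_f // mem_enum.
  have := maxT g gT; rewrite forest_free.
  have /(perm_map incidence)/perm_free -> :
      perm_eq (enum (g |: T)) (g :: enum T).
    apply: uniq_perm; rewrite ?enum_uniq //= ?mem_enum ?gT ?enum_uniq // => f.
    by rewrite !(inE, mem_enum).
  by rewrite /= free_cons frT andbT => /negP; rewrite negbK.
by rewrite (eqP frT) size_map -cardE.
Qed.

End Forests.

(** * Deletion and contraction of an edge with a parallel edge *)

Section ParallelEdges.
Variables (n : nat) (G : graph n).
Implicit Types (T : {set 'I_n}) (f g : 'I_n).

Lemma parallel_separates chi f g :
  parallel G f g -> separates (G := G) chi f = separates chi g.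
Proof. by rewrite /separates => /orP[] /eqP-> //=; rewrite eq_sym. Qed.

Lemma parallel_not_forest f g T : parallel G f g -> f != g ->
  f \in T -> g \in T -> ~ is_forest G T.
Proof.
move=> fg neq fT gT /forestP cut; have [chi [chif chig]] := cut f fT.
have := chig g gT; rewrite eq_sym neq => /(_ isT).
by rewrite -(parallel_separates chi fg) chif.
Qed.

Lemma tperm_separates chi f g h : parallel G f g ->
  separates (G := G) chi (tperm f g h) = separates chi h.
Proof.
by move=> fg; case: tpermP => // ->; rewrite (parallel_separates _ fg).
Qed.

(** A cut does not see the difference between parallel edges. *)
Lemma tperm_imset_forest f g T : parallel G f g ->
  is_forest G T -> is_forest G (tperm f g @: T).
Proof.
move=> fg /forestP cut; apply/forestP => _ /imsetP[h hT ->].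
have [chi [chih cutT]] := cut h hT; exists chi; rewrite tperm_separates //.
split=> // _ /imsetP[h' h'T ->]; rewrite (inj_eq perm_inj) tperm_separates //.
exact: cutT.
Qed.

Lemma tperm_imsetK f g T : tperm f g @: (tperm f g @: T) = T.
Proof.
rewrite -imset_comp (eq_imset (g := id)) ?imset_id // => h /=.
exact: tpermK.
Qed.

Lemma tperm_imset_max_forest f g T : parallel G f g ->
  max_forest G T -> max_forest G (tperm f g @: T).
Proof.
move=> fg /max_forestP[forT maxT]; apply/max_forestP; split.
  exact: tperm_imset_forest.
move=> h hT forh; apply: (maxT (tperm f g h)).
  by rewrite -[T](tperm_imsetK f g) mem_imset //; exact: perm_inj.
have := tperm_imset_forest fg forh.
by rewrite imsetU1 tperm_imsetK.
Qed.

End ParallelEdges.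

Section DeletionContraction.
Variables (m : nat) (G : graph m.+1) (e : 'I_m.+1).
Implicit Types (T : {set 'I_m}) (f g : 'I_m).

Lemma lift_mem T g : (lift e g \in lift e @: T) = (g \in T).
Proof. by rewrite mem_imset //; exact: lift_inj. Qed.

Lemma lift_notin T : (e \in lift e @: T) = false.
Proof. by apply/imsetP => -[g _ /eqP]; rewrite (negPf (neq_lift e g)). Qed.

Lemma lift_memU T g : (lift e g \in e |: lift e @: T) = (g \in T).
Proof. by rewrite in_setU1 eq_sym (negPf (neq_lift e g)) lift_mem. Qed.

Lemma deletion_forest T :
  is_forest (deletion G e) T <-> is_forest G (lift e @: T).
Proof.
split=> /forestP cut; apply/forestP.
  move=> _ /imsetP[g gT ->]; have [chi [chig cutT]] := cut g gT.
  exists chi; split=> // _ /imsetP[f fT ->]; rewrite (inj_eq lift_inj).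
  exact: cutT.
move=> g gT.
have [|chi [chig cutT]] := cut (lift e g); first by rewrite lift_mem.
exists chi; split=> // f fT fg; apply: cutT; first by rewrite lift_mem.
by rewrite (inj_eq lift_inj).
Qed.

Lemma merge_endsE (A : Type) (chi : vertex G -> A) v :
  chi (ends G e).1 = chi (ends G e).2 -> chi (merge_ends e v) = chi v.
Proof. by rewrite /merge_ends; case: eqP => // -> ->. Qed.

Lemma to_contracted_ends :
  to_contracted e (ends G e).1 = to_contracted e (ends G e).2.
Proof.
apply: val_inj; rewrite /= /merge_ends eqxx.
by case: eqP => // <-.
Qed.

(** Functions on the vertices of the contraction are the functions on vertices
    that take the same value at both ends of e. So a cut of a forest containing
    e that is not crossed by e descends to the contraction, and a relation
    between e and lifted edges restricts to a relation in the contraction,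
    which leaves at most a multiple of the nonzero incidence vector of e. *)
Lemma contraction_forest T : ~~ Defs.looping G e ->
  is_forest (contraction G e) T <-> is_forest G (e |: lift e @: T).
Proof.
move=> loop_e; split; last first.
  move=> /forestP cut; apply/forestP => g gT.
  have [|chi [chig cutT]] := cut (lift e g); first by rewrite lift_memU.
  have chie : chi (ends G e).1 = chi (ends G e).2.
    apply/eqP; rewrite -[_ == _]negbK.
    by apply: cutT; rewrite ?setU11 ?neq_lift.
  exists (fun w => chi (val w)); split.
    by rewrite /separates /= !merge_endsE.
  move=> f fT fg; rewrite /separates /= !merge_endsE //.
  by apply: cutT; rewrite ?lift_memU // (inj_eq lift_inj).
move=> /forest_independentP indep; apply/forest_independentP => c c0.
have c_lift f : f \in T -> c (lift e f) = 0.
  apply: (indep (fun f => c (lift e f))) => chi.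
  rewrite -[RHS](c0 (fun v => chi (to_contracted e v))).
  rewrite big_setU1 ?lift_notin //= to_contracted_ends subrr mulr0 add0r.
  by rewrite big_imset //= => ? ? _ _; exact: lift_inj.
move=> _ /setU1P[->|/imsetP[f fT ->]]; last exact: c_lift.
have := c0 (fun v => (v == (ends G e).1)%:R).
rewrite big_setU1 ?lift_notin //= big1 ?addr0.
  rewrite eqxx eq_sym -[_ == _]/(Defs.looping G e) (negPf loop_e).
  by rewrite subr0 mulr1.
by move=> _ /imsetP[f fT ->]; rewrite c_lift ?mul0r.
Qed.

Lemma contraction_max_forest T : ~~ Defs.looping G e ->
  max_forest (contraction G e) T <-> max_forest G (e |: lift e @: T).
Proof.
move=> loop_e; split=> /max_forestP[forT maxT]; apply/max_forestP.
  split; first exact/contraction_forest.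
  move=> g; case: (unliftP e g) => [f|] ->; last by rewrite setU11.
  rewrite lift_memU setUCA -imsetU1 => fT /contraction_forest-/(_ loop_e).
  exact: maxT.
split; first exact/contraction_forest.
move=> f fT /contraction_forest-/(_ loop_e); rewrite imsetU1 setUCA.
by apply: maxT; rewrite lift_memU.
Qed.

Variable f : 'I_m.
Hypothesis par_fe : parallel G (lift e f) e.

Lemma tperm_lift T : f \notin T ->
  tperm (lift e f) e @: (e |: lift e @: T) = lift e @: (f |: T).
Proof.
move=> fT; rewrite !imsetU1 tpermR; congr (_ |: _).
rewrite -[RHS]imset_id; apply: eq_in_imset => _ /imsetP[g gT ->] /=.
rewrite tpermD ?neq_lift // (inj_eq lift_inj).
by apply: contraNneq fT => ->.
Qed.

Lemma tperm_lift_inv T : f \notin T ->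
  tperm (lift e f) e @: (lift e @: (f |: T)) = e |: lift e @: T.
Proof. by move=> fT; rewrite -tperm_lift // tperm_imsetK. Qed.

Lemma lift_e_neq : lift e f != e.
Proof. by rewrite eq_sym neq_lift. Qed.

(** The parallel edge f is what makes a maximal forest of the deletion maximal
    in G: if e could be added to it then so could f, unless it contains f, in
    which case e and f form a cycle. *)
Lemma deletion_max_forest T :
  max_forest (deletion G e) T <-> max_forest G (lift e @: T).
Proof.
split=> /max_forestP[forT maxT]; apply/max_forestP.
  split; first exact/deletion_forest.
  move=> g; case: (unliftP e g) => [h|] ->.
    by rewrite lift_mem -imsetU1 => hT /deletion_forest; exact: maxT.
  move=> _ fore; have [fT|fT] := boolP (f \in T).
    by apply: (parallel_not_forest par_fe lift_e_neq) fore;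
       rewrite ?setU11 ?lift_memU.
  apply: (maxT f fT); apply/deletion_forest; rewrite -tperm_lift //.
  exact: tperm_imset_forest.
split; first exact/deletion_forest.
move=> g gT /deletion_forest; rewrite imsetU1; apply: maxT.
by rewrite lift_mem.
Qed.

(** Lift T to G by adding e, and exchange e with f. *)
Lemma contraction_deletion_max_forest T : ~~ Defs.looping G e ->
  max_forest (contraction G e) T <->
  f \notin T /\ max_forest (deletion G e) (f |: T).
Proof.
move=> loop_e; rewrite contraction_max_forest // deletion_max_forest; split.
  move=> maxT; have fT : f \notin T.
    apply/negP => fT; case/max_forestP: maxT => forT _.
    by apply: (parallel_not_forest par_fe lift_e_neq) forT;
       rewrite ?setU11 ?lift_memU.
  by split; rewrite // -tperm_lift //; apply: tperm_imset_max_forest.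
by case=> fT maxT; rewrite -tperm_lift_inv //; apply: tperm_imset_max_forest.
Qed.

End DeletionContraction.

(** * Ideals and their localization *)

Section IdealTheory.
Variable A : comPzRingType.
Implicit Types (S I : A -> Prop) (x y : A).

Definition is_ideal I : Prop :=
  [/\ I 0, forall x y, I x -> I y -> I (x + y) & forall a x, I x -> I (a * x)].

Lemma ideal_gen_is_ideal S : is_ideal (ideal_gen S).
Proof.
split=> [|x y [r [c [g [Sg ->]]]] [r' [c' [g' [Sg' ->]]]]
  |a x [r [c [g [Sg ->]]]]].
- by exists 0, (fun=> 0), (fun=> 0); rewrite big_ord0; split=> // -[].
- pose glue (h : 'I_r -> A) (h' : 'I_r' -> A) (i : 'I_(r + r')) :=
    match split i with inl j => h j | inr j => h' j end.
  exists (r + r'), (glue c c'), (glue g g'); split.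
    by move=> i; rewrite /glue; case: (split i).
  rewrite big_split_ord; congr (_ + _); apply: eq_bigr => i _; rewrite /glue.
    by rewrite -[lshift _ _]/(unsplit (inl i)) unsplitK.
  by rewrite -[rshift _ _]/(unsplit (inr i)) unsplitK.
- exists r, (fun i => a * c i), g; split=> //; rewrite mulr_sumr.
  by apply: eq_bigr => i _; rewrite mulrA.
Qed.

Lemma ideal_gen_incl S x : S x -> ideal_gen S x.
Proof.
by move=> Sx; exists 1, (fun=> 1), (fun=> x); rewrite big_ord1 mul1r.
Qed.

Lemma ideal_pow_is_ideal I j : is_ideal (ideal_pow I j).
Proof. exact: ideal_gen_is_ideal. Qed.

Lemma ideal_sum I (J : finType) (P : pred J) (F : J -> A) : is_ideal I ->
  (forall j, P j -> I (F j)) -> I (\sum_(j | P j) F j).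
Proof. by case=> I0 ID _ IF; elim/big_ind: _. Qed.

Lemma ideal_gen_min S I x :
  is_ideal I -> (forall y, S y -> I y) -> ideal_gen S x -> I x.
Proof.
move=> idI SI [r [c [g [Sg ->]]]]; apply: ideal_sum => // i _.
by case: idI => _ _; apply; apply: SI.
Qed.

Lemma ideal_subr I x y : is_ideal I -> I (x + y) -> I y -> I x.
Proof.
case=> _ ID IM Ixy Iy; rewrite -[x](addrK y) -mulN1r; apply: ID => //.
exact: IM.
Qed.

End IdealTheory.

Section Localization.
Variables (R : comNzRingType) (F : R) (q : prime_idealr R) (S : R -> Prop).
Local Notation germ := (germ F q).

Definition local_ideal : local_ring F q -> Prop :=
  ideal_gen (fun x => exists2 g, S g & x = germ g).

Lemma notin_prime_prod (I : finType) (s : I -> R) :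
  (forall i, s i \notin (q : pred R)) -> \prod_i s i \notin (q : pred R).
Proof.
move=> qs; elim/big_ind: _ => //; first exact: notin_prime1.
exact: notin_primeM.
Qed.

(** Membership in the extension of I to the local ring, in terms of
    fractions. *)
Definition clearable (I : R -> Prop) (x : local_ring F q) : Prop :=
  exists s y, [/\ s \notin (q : pred R), I y & germ s * x = germ y].

Lemma clearable_is_ideal I : is_ideal I -> is_ideal (clearable I).
Proof.
case=> I0 ID IM; split.
- exists 1, 0; split; rewrite ?rmorph0 ?mulr0 //; exact: notin_prime1.
- move=> x x' [s [y [qs Iy Ex]]] [s' [y' [qs' Iy' Ex']]].
  exists (s * s'), (s' * y + s * y'); split; first exact: notin_primeM.
    by apply: ID; apply: IM.
  by rewrite !rmorphD !rmorphM /= -Ex -Ex'; ring.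
move=> a x [s [y [qs Iy Ex]]]; have [b [t [qt Ea]]] := germ_frac a.
exists (t * s), (b * y); split; [exact: notin_primeM | exact: IM |].
by rewrite !rmorphM /= -Ex -Ea; ring.
Qed.

Lemma local_ideal_clearable x : local_ideal x -> clearable (ideal_gen S) x.
Proof.
apply: ideal_gen_min => [|_ [g Sg ->]].
  exact/clearable_is_ideal/ideal_gen_is_ideal.
exists 1, g; split; rewrite ?rmorph1 ?mul1r //; first exact: notin_prime1.
exact: ideal_gen_incl.
Qed.

Lemma local_ideal_germ y : ideal_gen S y -> local_ideal (germ y).
Proof.
move=> [r [c [g [Sg ->]]]].
exists r, (fun i => germ (c i)), (fun i => germ (g i)).
split; first by move=> i; exists (g i).
by rewrite rmorph_sum; apply: eq_bigr => i _; rewrite rmorphM.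
Qed.

Lemma local_pow_clearable j x :
  ideal_pow local_ideal j x -> clearable (ideal_pow (ideal_gen S) j) x.
Proof.
apply: ideal_gen_min => [|_ [g [Ig ->]]].
  exact/clearable_is_ideal/ideal_gen_is_ideal.
have [s /fin_all_exists[y sy]] :=
  fin_all_exists (fun i => local_ideal_clearable (Ig i)).
exists (\prod_i s i), (\prod_i y i); split.
- by apply: notin_prime_prod => i; case: (sy i).
- by apply: ideal_gen_incl; exists y; split=> // i; case: (sy i).
by rewrite !rmorph_prod /= -big_split; apply: eq_bigr => i _; case: (sy i).
Qed.

Lemma local_pow_germ j y :
  ideal_pow (ideal_gen S) j y -> ideal_pow local_ideal j (germ y).
Proof.
move=> [r [c [g [Sg ->]]]].
exists r, (fun i => germ (c i)), (fun i => germ (g i)).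
split.
  move=> i; have [h [Ih ->]] := Sg i; exists (fun l => germ (h l)).
  by rewrite rmorph_prod; split=> // l; apply: local_ideal_germ.
by rewrite rmorph_sum; apply: eq_bigr => i _; rewrite rmorphM.
Qed.

(** The preimage in R of the j-th power of the ideal generated by S in
    R / (F). *)
Definition pow_plus (j : nat) (a : R) : Prop :=
  exists y c, ideal_pow (ideal_gen S) j y /\ a = y + F * c.

Lemma pow_plus_is_ideal j : is_ideal (pow_plus j).
Proof.
have [I0 ID IM] := ideal_pow_is_ideal (ideal_gen S) j.
split.
- by exists 0, 0; rewrite mulr0 addr0.
- move=> _ _ [y [c [Iy ->]]] [y' [c' [Iy' ->]]].
  by exists (y + y'), (c + c'); split; [exact: ID | ring].
- move=> a _ [y [c [Iy ->]]].
  by exists (a * y), (a * c); split; [exact: IM | ring].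
Qed.

(** Localization is flat: a non-zero-divisor modulo the ideal J^j + (F) of R
    remains one in the local ring, since denominators can be cleared before
    cancelling u. The hypothesis on v holds for every generator of the ideal
    of u. *)
Lemma nonzerodivisor_localize j (u : R) (v : local_ring F q) :
  (forall a, pow_plus j (u * a) -> pow_plus j a) ->
  (exists w, germ u = w * v) ->
  nonzerodivisor_mod (ideal_pow local_ideal j) v.
Proof.
move=> nzd [w uE] h Ivh.
have [_ _ IM] := ideal_pow_is_ideal local_ideal j.
have cancel s x : s \notin (q : pred R) ->
    ideal_pow local_ideal j (germ s * x) -> ideal_pow local_ideal j x.
  move=> /(germ_invertible F)[t st] Isx.
  by rewrite -[x]mul1r -st [germ s * t]mulrC -mulrA; apply: IM.
have [a [s [qs Eh]]] := germ_frac h.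
apply: (cancel s) => //; rewrite Eh.
have : ideal_pow local_ideal j (germ (u * a)).
  rewrite rmorphM /= -Eh uE; have := IM (w * germ s) _ Ivh.
  by congr ideal_pow; ring.
case/local_pow_clearable => t [y [qt Iy /eqP]].
rewrite -rmorphM -subr_eq0 -rmorphB => /eqP/germ_eq0[t' [c [qt' Ec]]].
have /nzd[y' [c' [Iy' E']]] : pow_plus j (u * (t' * t * a)).
  exists (t' * y), c; split; last by rewrite -Ec; ring.
  by have [_ _] := ideal_pow_is_ideal (ideal_gen S) j; apply.
apply: (cancel (t' * t)); first exact: notin_primeM.
rewrite -rmorphM E' rmorphD rmorphM /=.
have -> : germ F = 0.
  by apply/germ_eq0; exists 1, 1; split; [exact: notin_prime1 | ring].
by rewrite mul0r addr0; apply: local_pow_germ.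
Qed.

End Localization.

(** * Polynomial vector fields *)

Section VectorFields.
Variables (k : comNzRingType) (n : nat).
Local Notation R := {mpoly k[n]}.
Implicit Types (a : 'I_n -> R) (g h : R).

Definition vfield a g : R := \sum_l a l * g^`M(l).

Fact vfield_is_linear a : linear (vfield a).
Proof.
move=> c g h; rewrite /vfield scaler_sumr -big_split; apply: eq_bigr => l _ /=.
by rewrite linearP mulrDr scalerAr.
Qed.
HB.instance Definition _ a :=
  GRing.isLinear.Build k R R _ (vfield a) (vfield_is_linear a).

Lemma vfieldM a g h : vfield a (g * h) = vfield a g * h + g * vfield a h.
Proof.
rewrite /vfield mulr_suml mulr_sumr -big_split; apply: eq_bigr => l _ /=.
by rewrite mderivM; ring.
Qed.

Lemma vfieldX a j : vfield a 'X_j = a j.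
Proof.
rewrite /vfield (bigD1 j) //= big1 ?addr0 => [|l lj]; rewrite mderivX mnm1E.
  have -> : (U_(j) - U_(j) = 0)%MM by apply/mnmP => l; rewrite !mnmE subnn.
  by rewrite eqxx scale1r mpolyX0 mulr1.
by rewrite eq_sym (negPf lj) scale0r mulr0.
Qed.

Lemma vfieldC a c : vfield a c%:MP = 0.
Proof. by rewrite /vfield big1 // => l _; rewrite mderivC mulr0. Qed.

Lemma mderiv_vfield a g j :
  (vfield a g)^`M(j) = vfield a (g^`M(j)) + \sum_l (a l)^`M(j) * g^`M(l).
Proof.
rewrite /vfield raddf_sum -big_split; apply: eq_bigr => l _ /=.
by rewrite mderivM addrC mderiv_comm.
Qed.

Lemma mulX_mderivX j (al : 'X_{1..n}) :
  'X_j * ('X_[al] : R)^`M(j) = (al j)%:R *: 'X_[al].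
Proof.
rewrite mderivX -scalerAr; have [->|nz] := eqVneq (al j) 0%N.
  by rewrite !scale0r.
by rewrite mulrC -mpolyXD submK // lep1mP.
Qed.

Lemma mpoly_ring_ind (P : R -> Prop) :
  (forall c, P c%:MP) -> (forall j, P 'X_j) ->
  (forall g h, P g -> P h -> P (g + h)) ->
  (forall g h, P g -> P h -> P (g * h)) -> forall g, P g.
Proof.
move=> PC PX PD PM g; have P1 : P 1 by rewrite -mpolyC1.
rewrite (mpolyE g); elim/big_ind: _ => [|//|al _]; first by rewrite -mpolyC0.
rewrite -mul_mpolyC mpolyXE_id; apply: (PM) => //.
elim/big_ind: _ => [//|g1 g2|j _]; first exact: PM.
by elim: (al j) => [|d IH]; rewrite ?expr0 // exprS; apply: PM.
Qed.

End VectorFields.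

(** Both sides are derivations along the substitution s, so that it is enough to
    compare them on the variables: if the field b is u times the image of the
    field a on coordinates, then it is so on all functions. *)
Lemma vfield_comp (k : comNzRingType) (n n' : nat) (s : n.-tuple {mpoly k[n']})
    (u : {mpoly k[n']}) (a : 'I_n' -> {mpoly k[n']})
    (b : 'I_n -> {mpoly k[n]}) :
  (forall j, u * vfield a (tnth s j) = b j \mPo s) ->
  forall g, u * vfield a (g \mPo s) = vfield b g \mPo s.
Proof.
move=> ab; apply: mpoly_ring_ind => [c|j|g h gE hE|g h gE hE].
- by rewrite comp_mpolyC !vfieldC mulr0 comp_mpoly0.
- by rewrite vfieldX comp_mpolyXU -ab (tnth_nth 0).
- by rewrite !raddfD /= mulrDr gE hE.
by rewrite vfieldM rmorphM rmorphD !rmorphM /= vfieldM -gE -hE; ring.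
Qed.

Section TwistedField.
Variables (k : comNzRingType) (n : nat).
Variables (a : 'I_n -> {mpoly k[n]}) (r : {mpoly k[n]}).

(** The vector field acting on sections of a line bundle, trivialized with
    connection coefficient -r; the twist makes spaces of polynomials of
    bounded degree stable under a quadratic vector field. *)
Definition twisted_field (g : {mpoly k[n]}) : {mpoly k[n]} :=
  vfield a g - r * g.

Fact twisted_field_is_linear : linear twisted_field.
Proof.
move=> c g h; rewrite /twisted_field linearP scalerBr scalerAr mulrDr opprD.
by rewrite addrACA.
Qed.
HB.instance Definition _ := GRing.isLinear.Build k {mpoly k[n]} {mpoly k[n]} _
  twisted_field twisted_field_is_linear.

End TwistedField.

Section StableIdeals.
Variables (k : fieldType) (n : nat).
Local Notation R := {mpoly k[n]}.
Variables (a : 'I_n -> R) (F : R) (r : R).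
Hypothesis DF : vfield a F = F * r.

(** A vector field tangent to F = 0 is tangent to its singularity subscheme:
    its commutators with the partial derivatives are vector fields, so they send
    F into the ideal of partial derivatives. *)
Lemma sing_ideal_stable g :
  ideal_gen (sing_gens F) g -> ideal_gen (sing_gens F) (vfield a g).
Proof.
have idJ := ideal_gen_is_ideal (sing_gens F); have [J0 JD JM] := idJ.
have JF : ideal_gen (sing_gens F) F by apply: ideal_gen_incl; left.
have JdF j : ideal_gen (sing_gens F) F^`M(j).
  by apply: ideal_gen_incl; right; exists j.
pose I h := ideal_gen (sing_gens F) h /\ ideal_gen (sing_gens F) (vfield a h).
suff: forall h, ideal_gen (sing_gens F) h -> I h by move=> JI /JI[].
move=> h; apply: ideal_gen_min => [|_ [->|[j ->]]].
- split=> [|x y [Jx JDx] [Jy JDy]|b x [Jx JDx]]; split=> //; rewrite ?raddf0 //;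
    rewrite ?raddfD ?vfieldM; auto.
- by split=> //; rewrite DF mulrC; apply: JM.
split=> //; apply: (@ideal_subr _ _ _ (\sum_l (a l)^`M(j) * F^`M(l)) idJ).
  rewrite -mderiv_vfield DF mderivM mulrC; apply: JD; first exact: JM.
  by rewrite mulrC; apply: JM.
by apply: ideal_sum => // l _; apply: JM.
Qed.

Lemma ideal_pow_stable j g :
  ideal_pow (ideal_gen (sing_gens F)) j g ->
  ideal_pow (ideal_gen (sing_gens F)) j (vfield a g).
Proof.
have idJ := ideal_pow_is_ideal (ideal_gen (sing_gens F)) j.
have [J0 JD JM] := idJ.
pose I h := ideal_pow (ideal_gen (sing_gens F)) j h /\
            ideal_pow (ideal_gen (sing_gens F)) j (vfield a h).
suff: forall h, ideal_pow (ideal_gen (sing_gens F)) j h -> I h.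
  by move=> JI /JI[].
move=> h; apply: ideal_gen_min => [|_ [f [If ->]]].
  split=> [|x y [Jx JDx] [Jy JDy]|b x [Jx JDx]]; split=> //; rewrite ?raddf0 //;
    rewrite ?raddfD ?vfieldM; auto.
split; first by apply: ideal_gen_incl; exists f.
(* the Leibniz rule for a product of j factors *)
have -> : vfield a (\prod_(i < j) f i) =
    \sum_(i < j) \prod_(l < j) (if l == i then vfield a (f i) else f l).
  elim: j f {J0 JD JM idJ I h If} => [|j IH] f.
    by rewrite !big_ord0 -mpolyC1 vfieldC.
  rewrite big_ord_recl vfieldM IH big_ord_recl big_ord_recl /=.
  congr (_ * _ + _); rewrite mulr_sumr; apply: eq_bigr => i _.
  rewrite big_ord_recl /=; congr (_ * _); apply: eq_bigr => l _.
apply: ideal_sum => // i _; apply: ideal_gen_incl.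
exists (fun l => if l == i then vfield a (f i) else f l); split=> // l.
by case: eqP => // _; apply: sing_ideal_stable.
Qed.

Lemma pow_plus_stable j g :
  pow_plus F (sing_gens F) j g -> pow_plus F (sing_gens F) j (vfield a g).
Proof.
move=> [y [c [Jy ->]]]; exists (vfield a y), (r * c + vfield a c).
split; first exact: ideal_pow_stable.
by rewrite raddfD /= vfieldM DF; ring.
Qed.

End StableIdeals.

(** * Cancellation along a transverse vector field *)

Section Triangularizable.
Variables (k : fieldType) (n : nat).
Hypothesis char_k : [pchar k] =i pred0.
Local Notation R := {mpoly k[n]}.
Variable (E : {linear R -> R}).

(** Vectors killed by a product of operators E - c. This form makes sense
    without exhibiting a finite-dimensional space stable under E, and gives the
    induction of [triangularizable_cancel]. *)
Inductive triangularizable : R -> Prop :=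
| Tri0 : triangularizable 0
| TriS c h : triangularizable (E h - c *: h) -> triangularizable h.

Lemma tri_shift c h : triangularizable h -> triangularizable (E h - c *: h).
Proof.
elim=> [|d g _ IH]; first by rewrite raddf0 scaler0 subrr; exact: Tri0.
apply: (TriS (c := d)); rewrite [X in triangularizable X](_ : _ =
  E (E g - d *: g) - c *: (E g - d *: g)) //.
by rewrite !linearB !linearZ /= !scalerA [d * c]mulrC; ring.
Qed.

Lemma triD g h :
  triangularizable g -> triangularizable h -> triangularizable (g + h).
Proof.
move=> tg; elim: tg h => [|c x _ IH] h th; first by rewrite add0r.
apply: (TriS (c := c)); rewrite linearD scalerDr opprD addrACA.
by apply: IH; exact: tri_shift.
Qed.

Lemma triZ d h : triangularizable h -> triangularizable (d *: h).
Proof.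
elim=> [|c x _ IH]; first by rewrite scaler0; exact: Tri0.
apply: (TriS (c := c)); rewrite linearZ /= scalerA mulrC -scalerA -scalerBr.
exact: IH.
Qed.

Lemma tri_sum (I : eqType) (s : seq I) (G : I -> R) :
  (forall i, i \in s -> triangularizable (G i)) ->
  triangularizable (\sum_(i <- s) G i).
Proof.
move=> tG; rewrite big_seq; elim/big_ind: _ => //; first exact: Tri0.
exact: triD.
Qed.

Lemma natr_cancel (I : R -> Prop) d h :
  is_ideal I -> I (d.+1%:R * h) -> I h.
Proof.
move=> [_ _ IM] /(IM ((d.+1%:R)^-1)%:MP).
suff -> : ((d.+1%:R)^-1)%:MP * (d.+1%:R * h) = h by [].
have nz : d.+1%:R != 0 :> k.
  by rewrite (pcharf0P _).1.
have -> : d.+1%:R = (d.+1%:R)%:MP :> R by rewrite mpolyC_nat.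
by rewrite mulrA -mpolyCM mulVf ?mpolyC1 ?mul1r.
Qed.

(** If E is a first-order operator that preserves I and its symbol maps u to 1
    modulo u, then applying E to u^d h gives d u^(d-1) h up to multiples of
    u^d h and the term u^d E h. When E h is a multiple of h modulo I, this
    lowers d. *)
Lemma triangularizable_cancel (I : R -> Prop) (u c h : R) :
  is_ideal I -> (forall g, I g -> I (E g)) ->
  (forall g, E (u * g) = (1 + u * c) * g + u * E g) ->
  triangularizable h -> forall d, I (u ^+ d * h) -> I h.
Proof.
move=> idI IE Eu; have [I0 ID IM] := idI.
have EuX d g : E (u ^+ d * g) =
    d%:R * (1 + u * c) * u ^+ d.-1 * g + u ^+ d * E g.
  elim: d g => [|d IH] g; first by rewrite /= expr0 !mul0r !mul1r add0r.
  rewrite exprS -mulrA Eu IH -[d.+1%:R]natr1 /=.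
  by case: d {IH} => [|d]; rewrite ?expr0 ?exprS /=; ring.
elim=> // lam {}h _ IH d Ih.
(* u * E (u ^+ d * h) is in I, and is u ^+ d.+1 * E h up to multiples of
   u ^+ d * h: hence (E - lam) h has a power of u that takes it into I *)
have Ih' : I (E h - lam *: h).
  apply: (IH d.+1); rewrite -mul_mpolyC.
  have -> : u ^+ d.+1 * (E h - lam%:MP * h) = u * E (u ^+ d * h) +
      (- (d%:R * (1 + u * c)) - u * lam%:MP) * (u ^+ d * h).
    by rewrite EuX exprS; case: d {Ih} => [|d] /=; rewrite ?exprS; ring.
  by apply: ID; apply: IM => //; apply: IE.
(* modulo I the operator E now acts on h as lam, and E (u ^+ d.+1 * h) reduces
   to d.+1%:R * (u ^+ d * h) *)
elim: d Ih => [|d IHd] Ih; first by rewrite expr0 mul1r in Ih.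
apply/IHd/(natr_cancel (d := d) idI).
have -> : d.+1%:R * (u ^+ d * h) = E (u ^+ d.+1 * h) +
    (- (d.+1%:R * c) - lam%:MP) * (u ^+ d.+1 * h) +
    (- u ^+ d.+1) * (E h - lam *: h).
  by rewrite EuX /= [u ^+ d.+1]exprS -mul_mpolyC; ring.
by apply: (ID); [apply: (ID); [exact: IE | exact: IM] | exact: IM].
Qed.

End Triangularizable.

(** * Graph polynomials *)

Section Cotrees.
Variables (k : comNzRingType) (n : nat).
Implicit Types (T : {set 'I_n}) (P : pred {set 'I_n}).

Definition cotree T : {mpoly k[n]} := \prod_(f | f \notin T) 'X_f.

Lemma mulX_mderiv_cotree l T :
  'X_l * (cotree T)^`M(l) = (l \notin T)%:R *: cotree T.
Proof.
have -> : cotree T = 'X_[(\sum_(f | f \notin T) U_(f))%MM].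
  by rewrite /cotree mprodXE.
rewrite mulX_mderivX mnm_sumE; congr (_%:R *: _).
rewrite big_mkcond (bigD1 l) //= big1 ?addn0 => [|f fl].
  by rewrite mnm1E eqxx; case: (l \in T).
by case: ifP => // _; rewrite mnm1E (negPf fl).
Qed.

(** Euler's formula for a sum of squarefree monomials of degree d. *)
Lemma euler_cotrees P d : (forall T, P T -> #|~: T| = d) ->
  vfield (fun l => 'X_l) (\sum_(T | P T) cotree T)
  = d%:R * \sum_(T | P T) cotree T.
Proof.
move=> Pd; rewrite raddf_sum mulr_sumr; apply: eq_bigr => T /Pd <- /=.
rewrite /vfield; under eq_bigr do rewrite mulX_mderiv_cotree.
rewrite -scaler_suml -mul_mpolyC -natr_sum mpolyC_nat; congr (_%:R * _).
rewrite -sum1_card [RHS]big_mkcond; apply: eq_bigr => l _.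
by rewrite inE; case: (l \in T).
Qed.

Lemma mulX_mderiv_cotrees P f :
  'X_f * (\sum_(T | P T) cotree T)^`M(f)
  = \sum_(T | P T && (f \notin T)) cotree T.
Proof.
rewrite raddf_sum mulr_sumr /= big_mkcondr; apply: eq_bigr => T _ /=.
by rewrite mulX_mderiv_cotree; case: (f \in T); rewrite ?scale0r ?scale1r.
Qed.

Lemma graph_polyE (G : graph n) :
  graph_poly k G = \sum_(T | max_forest G T) cotree T.
Proof. by []. Qed.

End Cotrees.

Lemma max_forest_exists (n : nat) (G : graph n) : exists T, max_forest G T.
Proof.
have for0 : is_forest G set0 by apply/forestP => g; rewrite inE.
by have [T maxT _] := maxset_exists for0; exists T.
Qed.

Section GraphPolynomials.
Variables (k : comNzRingType) (m : nat) (G : graph m.+1).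
Variables (e : 'I_m.+1) (f : 'I_m).
Hypothesis loop_e : ~~ Defs.looping G e.
Hypothesis par_fe : parallel G (lift e f) e.

Local Notation P := (graph_poly k (deletion G e)).
Local Notation Q := (graph_poly k (contraction G e)).
(** The part of P that does not involve t_f. *)
Let B : {mpoly k[m]} :=
  \sum_(T | max_forest (deletion G e) T && (f \in T)) cotree k T.

Lemma contraction_poly_cotrees : Q = 'X_f * B.
Proof.
rewrite /graph_poly /B mulr_sumr.
rewrite [RHS](reindex_onto (fun T => f |: T) (fun T => T :\ f)) /=; last first.
  by move=> T /andP[_ fT]; rewrite setD1K.
have inE' T : [&& max_forest (deletion G e) (f |: T), f \in f |: T
    & (f |: T) :\ f == T] = max_forest (contraction G e) T.
  rewrite setU11 /=; apply/idP/idP => [/andP[maxT /eqP TE]|].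
    apply/(contraction_deletion_max_forest par_fe) => //; split=> //.
    by rewrite -TE setD11.
  move/(contraction_deletion_max_forest par_fe) => /(_ loop_e)[fT ->].
  by rewrite setU1K ?eqxx.
under [RHS]eq_bigl do rewrite -andbA inE'.
apply: eq_bigr => T /(contraction_deletion_max_forest par_fe)-/(_ loop_e)[fT _].
rewrite (bigD1 f) //=; congr (_ * _); apply: eq_bigl => g.
by rewrite !inE negb_or andbC.
Qed.

Lemma contraction_polyE : Q = 'X_f * (P - 'X_f * P^`M(f)).
Proof.
rewrite contraction_poly_cotrees; congr (_ * _).
rewrite graph_polyE mulX_mderiv_cotrees.
by rewrite [X in X - _](bigID (fun T : {set _} => f \in T)) /= addrK.
Qed.

(** The degree of P, computed on an arbitrary maximal forest. *)
Definition corank : nat := #|~: xchoose (max_forest_exists (deletion G e))|.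

Lemma card_cotree T : max_forest (deletion G e) T -> #|~: T| = corank.
Proof.
move=> maxT; rewrite /corank [LHS]cardsCs [RHS]cardsCs !setCK.
rewrite (card_max_forest maxT); congr (_ - _)%N; symmetry.
by rewrite (card_max_forest (xchooseP (max_forest_exists _))).
Qed.

Lemma corank_gt0 : ~~ is_forest (deletion G e) setT -> (0 < corank)%N.
Proof.
apply: contraR; rewrite -eqn0Ngt cards_eq0 => /eqP/(congr1 (@setC _)).
rewrite setCK setC0 => TE.
have := xchooseP (max_forest_exists (deletion G e)).
by rewrite TE => /max_forestP[].
Qed.

Lemma euler_deletion : vfield (fun l => 'X_l) P = corank%:R * P.
Proof. by apply: euler_cotrees => T; exact: card_cotree. Qed.

(** In the affine coordinates t_e = 1, the generator of the flow that moves t_e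
    and t_f with 1/t_e + 1/t_f constant. Moving t_e amounts to scaling all the
    affine coordinates, hence the Euler field. *)
Definition flow_field (l : 'I_m) : {mpoly k[m]} :=
  'X_l + (l == f)%:R * 'X_f ^+ 2.

Lemma vfield_flow g : vfield flow_field g =
  vfield (fun l => 'X_l) g + 'X_f * ('X_f * g^`M(f)).
Proof.
rewrite /vfield /flow_field; under eq_bigr do rewrite mulrDl.
rewrite big_split /=; congr (_ + _).
rewrite (bigD1 f) //= big1 ?addr0 => [|l /negPf->]; last by rewrite !mul0r.
by rewrite eqxx mul1r expr2 mulrA.
Qed.

(** The field multiplies Q = t_f B by d + 1 + t_f. It multiplies P by d, up to
    the term t_f (t_f dP/dt_f) = t_f (P - B) = t_f P - Q, which makes up for
    the difference. *)
Lemma flow_deletion_contraction :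
  vfield flow_field (P + Q) = (corank%:R + 'X_f) * (P + Q).
Proof.
have flowB : vfield flow_field B = corank%:R * B.
  rewrite vfield_flow (@euler_cotrees _ _ _ corank); last first.
    by move=> T /andP[/card_cotree].
  rewrite mulX_mderiv_cotrees [X in _ + _ * X]big1 ?mulr0 ?addr0 // => T.
  by rewrite -andbA andbN andbF.
have PE : 'X_f * P^`M(f) = P - B.
  rewrite graph_polyE mulX_mderiv_cotrees.
  rewrite [X in X - _](bigID (fun T : {set _} => f \in T)) /=.
  by rewrite addrAC subrr add0r.
rewrite raddfD /= vfield_flow euler_deletion PE contraction_poly_cotrees.
by rewrite vfieldM vfieldX flowB /flow_field eqxx /= mul1r expr2; ring.
Qed.

(** The deletion-contraction formula Psi = t_e P + Q at t_e = 1, for the edge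
    variables specialized to an arbitrary ring. *)
Lemma graph_poly_comp (A : comNzRingType)
    (phi : {rmorphism {mpoly k[m.+1]} -> A})
    (psi : {rmorphism {mpoly k[m]} -> A}) :
  phi 'X_e = 1 -> (forall j, phi 'X_(lift e j) = psi 'X_j) ->
  phi (graph_poly k G) = psi (P + Q).
Proof.
move=> phi_e phi_lift.
have prodE (T : {set 'I_m.+1}) : phi (\prod_(g | g \notin T) 'X_g) =
    \prod_(j | lift e j \notin T) psi 'X_j.
  rewrite rmorph_prod big_mkcond /= (bigD1_ord e) //= phi_e if_same mul1r.
  by rewrite -big_mkcond; apply: eq_bigr => j _; rewrite phi_lift.
rewrite /graph_poly rmorph_sum rmorphD !rmorph_sum /=.
rewrite (bigID (fun T : {set _} => e \notin T)) /=; congr (_ + _).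
  rewrite (reindex_onto (fun S : {set 'I_m} => lift e @: S)
    (fun T : {set 'I_m.+1} => lift e @^-1: T)) /=.
    apply: eq_big => [S|S _]; last first.
      by rewrite prodE rmorph_prod; apply: eq_bigl => j; rewrite lift_mem.
    rewrite lift_notin andbT [X in _ && X](_ : _ = true); last first.
      by apply/eqP/setP => j; rewrite inE lift_mem.
    by rewrite andbT; apply/idP/idP => /(deletion_max_forest par_fe).
  move=> T /andP[_ eT]; apply/setP => g; case: (unliftP e g) => [j|] ->.
    by rewrite lift_mem inE.
  by rewrite lift_notin (negPf eT).
rewrite (reindex_onto (fun S : {set 'I_m} => e |: lift e @: S)
  (fun T : {set 'I_m.+1} => lift e @^-1: T)) /=.
  apply: eq_big => [S|S _]; last first.
    by rewrite prodE rmorph_prod; apply: eq_bigl => j; rewrite lift_memU.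
  rewrite setU11 /= andbT [X in _ && X](_ : _ = true); last first.
    by apply/eqP/setP => j; rewrite inE lift_memU.
  by rewrite andbT; apply/idP/idP => /(contraction_max_forest _ loop_e).
move=> T /andP[_]; rewrite negbK => eT.
apply/setP => g; case: (unliftP e g) => [j|] ->; first by rewrite lift_memU inE.
by rewrite setU11 eT.
Qed.

End GraphPolynomials.

(** * The charts of the blow-up *)

Section Chart.
Variables (k : fieldType) (m : nat) (i f : 'I_m).
Local Notation R := {mpoly k[m]}.

(** The lift of [flow_field] to the i-th chart, divided by the equation 'X_i of
    the exceptional divisor. It is d/du + s_f^2 d/ds_f if f is not i, and
    (1 + u) d/du - sum_j s_j d/ds_j if f = i, where u = t_f. *)
Definition chart_field (l : 'I_m) : R :=
  if l == i then 1 + (i == f)%:R * 'X_i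
  else (l == f)%:R * 'X_f ^+ 2 - (i == f)%:R * 'X_l.

Lemma chart_field_comp (s : m.-tuple R) :
  (forall j, tnth s j = if j == i then 'X_i else 'X_i * 'X_j) ->
  forall g, 'X_i * vfield chart_field (g \mPo s)
            = vfield (flow_field k f) g \mPo s.
Proof.
move=> sE; apply: vfield_comp => j; rewrite sE /flow_field.
rewrite raddfD /= rmorphM rmorph_nat rmorphXn /= !comp_mpolyXU -!tnth_nth !sE.
rewrite (fun_if (vfield chart_field)) vfieldM !vfieldX /chart_field eqxx.
have [F0 T1] : false%:R = 0 :> R /\ true%:R = 1 :> R by [].
have [->|ji] := eqVneq j i.
  by have [->|_] := eqVneq i f; rewrite ?F0; ring.
have [fi|_] := eqVneq i f; last by have [->|_] := eqVneq j f; rewrite F0; ring.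
by rewrite -fi (negPf ji) F0 T1; ring.
Qed.

Lemma vfieldX_chart_eq (al : 'X_{1..m}) : i = f ->
  vfield chart_field ('X_[al] : R) =
  (al i)%:R *: 'X_[al - U_(i)] +
  ((al i)%:R - \sum_(l | l != i) (al l)%:R) *: 'X_[al].
Proof.
move=> fi; rewrite /vfield (bigD1 i) //= /chart_field !eqxx -fi eqxx mul1r.
rewrite mulrDl mul1r mulX_mderivX mderivX -addrA scalerBl; congr (_ + (_ + _)).
rewrite scaler_suml -sumrN; apply: eq_bigr => l li.
by rewrite (negPf li) mul0r mul1r add0r mulNr mulX_mderivX.
Qed.

Lemma vfieldX_chart_neq (al : 'X_{1..m}) : i != f ->
  vfield chart_field ('X_[al] : R) =
  (al i)%:R *: 'X_[al - U_(i)] + (al f)%:R *: ('X_f * 'X_[al]).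
Proof.
move=> fi; rewrite /vfield (bigD1 i) //= /chart_field !eqxx (negPf fi).
rewrite mul0r addr0 mul1r mderivX; congr (_ + _).
rewrite (bigD1 f) ?[f == i]eq_sym ?fi //= (negPf fi) eqxx big1 ?addr0.
  by rewrite mul1r mul0r subr0 expr2 -mulrA mulX_mderivX -scalerAr.
by move=> l /andP[/negPf-> /negPf->]; rewrite !mul0r subr0 mul0r.
Qed.

(** On monomials the field is triangular for the degree in u, with the integer
    eigenvalues given by degree in u minus degree in the other variables. *)
Lemma chart_triangularizable_eq h : i = f ->
  triangularizable (twisted_field chart_field 0) h.
Proof.
move=> fi; rewrite (mpolyE h); apply: tri_sum => al _; apply: triZ.
elim: {al}(al i) {-2}al (erefl (al i)) => [|d IH] al ald;
  apply: (TriS (c := (al i)%:R - \sum_(l | l != i) (al l)%:R));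
  rewrite /= /twisted_field mul0r subr0 vfieldX_chart_eq // addrK ald.
  by rewrite scale0r; exact: Tri0.
by apply/triZ/IH; rewrite mnmBE mnm1E eqxx ald subn1.
Qed.

(** The field s^2 d/ds, where s is the variable of index f, raises the degree,
    but it is the affine form of a nilpotent vector field on the projective
    line. Twisted by the line bundle of degree N, that is as s^2 d/ds - N s, it
    maps s^N to 0 and is nilpotent on the polynomials of degree at most N in s.
    So is its sum with d/du: each term lowers the degree in u or raises that in
    s, whence the induction on the degree in u plus N minus the degree in s.
    Any bound N for the degree of h in s would do, and [msize h] is one. *)
Lemma chart_triangularizable_neq h : i != f ->
  triangularizable (twisted_field chart_field ((msize h)%:R * 'X_f)) h.
Proof.
move=> fi; have := leqnn (msize h); move: {2 3}(msize h) => N hN.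
rewrite [X in triangularizable _ X]mpolyE.
apply: tri_sum => al alh; apply: triZ.
have {alh hN} : (al f <= N)%N.
  apply: leq_trans hN; apply: leq_trans (ltnW (msize_mdeg_lt alh)).
  by rewrite mdegE (bigD1 f) //= leq_addr.
have [d] := ubnP (al i + (N - al f))%N.
elim: d al => // d IH al; rewrite ltnS => ald alN.
apply: (TriS (c := 0)); rewrite scale0r subr0 /= /twisted_field.
rewrite vfieldX_chart_neq //.
have -> : N%:R * 'X_f * 'X_[al] = N%:R *: ('X_f * 'X_[al]) :> R.
  by rewrite -mul_mpolyC mpolyC_nat mulrA.
rewrite -addrA -scalerBl; apply: triD.
  have [->|ali] := eqVneq (al i) 0%N; first by rewrite scale0r; exact: Tri0.
  apply/triZ/IH; rewrite !mnmBE !mnm1E ?eqxx (negPf fi) subn0 //.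
  apply: leq_trans ald; rewrite -addSn leq_add2r.
  by case: (al i) ali => // c _; rewrite subn1.
have [->|] := eqVneq (al f) N; first by rewrite subrr scale0r; exact: Tri0.
move=> alf; have {alf} {}alN : (al f < N)%N by rewrite ltn_neqAle alf.
rewrite -mpolyXD; apply/triZ/IH; rewrite !mnmDE !mnm1E eqxx ?add1n //.
rewrite eq_sym (negPf fi) add0n; apply: leq_trans ald.
by rewrite ltn_add2l -(subnSK alN).
Qed.

Lemma vfieldX_chart_div : vfield chart_field 'X_i = 1 + 'X_i * (i == f)%:R.
Proof. by rewrite vfieldX /chart_field eqxx mulrC. Qed.

Lemma chart_nonzerodivisor (char_k : [pchar k] =i pred0) (I : R -> Prop) h :
  is_ideal I -> (forall g, I g -> I (vfield chart_field g)) ->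
  I ('X_i * h) -> I h.
Proof.
move=> idI ID Iuh; have [_ IA IM] := idI.
have [r tri_h] : exists r, triangularizable (twisted_field chart_field r) h.
  have [fi|fi] := eqVneq i f.
    by exists 0; apply: chart_triangularizable_eq.
  by exists ((msize h)%:R * 'X_f); apply: chart_triangularizable_neq.
apply: (triangularizable_cancel char_k idI _ _ tri_h (d := 1)
          (u := 'X_i) (c := (i == f)%:R)) => //.
- move=> g Ig; rewrite /= /twisted_field -mulNr.
  by apply: IA; [exact: ID | exact: IM].
by move=> g; rewrite /= /twisted_field vfieldM vfieldX_chart_div; ring.
Qed.

End Chart.

(** The ideal of the proper transform is the saturation of that of the
    pull-back with respect to u, and saturation preserves stability under a
    vector field: if u^r g is in the stable ideal then so is
    u^(r+1) D g = u D (u^r g) - r (D u) u^r g. *)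
Lemma proper_transform_flow (k : fieldType) (m : nat) (e : 'I_m.+1) (i f : 'I_m)
    (P : {mpoly k[m.+1]}) (F w : {mpoly k[m]}) :
  'X_i * vfield (chart_field k i f) (P \mPo blowdown k e i)
    = w * (P \mPo blowdown k e i) ->
  proper_transform_eq e i P F ->
  exists r, vfield (chart_field k i f) F = F * r.
Proof.
set Phi := P \mPo _ => flowPhi propF.
have [|r [c Fr]] := (propF F).1; first by exists 1; rewrite mulr1.
have [|r' ->] := (propF (vfield (chart_field k i f) F)).2; last by exists r'.
pose D := vfield (chart_field k i f).
exists r.+1, (w * c + 'X_i * D c - r%:R * D 'X_i * c).
have DX : 'X_i * D ('X_i ^+ r) = r%:R * D 'X_i * 'X_i ^+ r.
  elim: {Fr} r => [|r IH]; first by rewrite -mpolyC1 /D vfieldC !mul0r mulr0.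
  rewrite exprS /D vfieldM mulrDr [X in _ + X]mulrCA IH /D -[r.+1%:R]natr1.
  by ring.
have : 'X_i * D ('X_i ^+ r * F) = 'X_i * D (Phi * c) by rewrite Fr.
rewrite /D !vfieldM -/D !mulrDr !mulrA DX flowPhi => E.
have -> : 'X_i ^+ r.+1 * D F =
    w * Phi * c + 'X_i * Phi * D c - r%:R * D 'X_i * ('X_i ^+ r * F).
  by rewrite -E exprS; ring.
by rewrite Fr; ring.
Qed.

Theorem lemma2p3 (k : closedFieldType) (char_k : [pchar k] =i pred0)
    (m : nat) (G : graph m.+1) (e : 'I_m.+1) :
  regular_edge G e ->
  (exists2 f : 'I_m.+1, f != e & parallel G f e) ->
  (* (I) *)
  ideal_gen
    (fun g => exists f : 'I_m, g = (graph_poly k (deletion G e))^`M(f))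
    (graph_poly k (contraction G e))
  /\
  (* (II) *)
  (forall (i : 'I_m) (F : {mpoly k[m]}) (q : prime_idealr {mpoly k[m]}),
     proper_transform_eq e i (graph_poly k G) F ->
     'X_i \in (q : pred {mpoly k[m]}) ->
     (forall g, sing_gens F g -> g \in (q : pred {mpoly k[m]})) ->
     forall v : local_ring F q,
       local_equation 'X_i v ->
       exists j0 : nat, forall j : nat, (j0 <= j)%N ->
         nonzerodivisor_mod (ideal_pow (sing_local_ideal (F := F) (q := q)) j) v).
Proof.
move=> /and3P[_ loop_e cyc] [f' f'e par].
case: (unliftP e f') f'e par => [f|] ->; last by rewrite eqxx.
move=> _ par {f'}; split.
  set J := ideal_gen _; have idJ : is_ideal J by exact: ideal_gen_is_ideal.
  have [_ JD JM] := idJ.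
  have JdP l : J (graph_poly k (deletion G e))^`M(l).
    by apply: ideal_gen_incl; exists l.
  have JP : J (graph_poly k (deletion G e)).
    have := corank_gt0 cyc; have := euler_deletion k G e.
    case: (corank G e) => // d euler _.
    apply: (natr_cancel char_k idJ (d := d)); rewrite -euler.
    by apply: ideal_sum => // l _; apply: JM.
  rewrite (contraction_polyE k loop_e par) -mulNr.
  by apply/JM/JD => //; apply: JM.
(* every power j works *)
move=> i F q propF _ _ v vE; exists 0 => j _.
have [r DF] : exists r, vfield (chart_field k i f) F = F * r.
  pose s := [tuple tnth (blowdown k e i) (lift e l) | l < m].
  have sE l : tnth s l = if l == i then 'X_i else 'X_i * 'X_l.
    by rewrite !tnth_mktuple liftK.
  have PhiE : graph_poly k G \mPo blowdown k e i =
      (graph_poly k (deletion G e) + graph_poly k (contraction G e)) \mPo s.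
    apply: (@graph_poly_comp k m G e f loop_e par _
      (comp_mpoly (blowdown k e i)) (comp_mpoly s)).
      by rewrite /= comp_mpolyXU -tnth_nth tnth_mktuple unlift_none.
    by move=> l; rewrite /= !comp_mpolyXU -!tnth_nth [RHS]tnth_mktuple.
  apply: (proper_transform_flow _ propF (w := ((corank G e)%:R + 'X_f) \mPo s)).
  by rewrite PhiE chart_field_comp // flow_deletion_contraction // rmorphM.
apply: (@nonzerodivisor_localize _ F q (sing_gens F) j 'X_i).
  move=> a; apply: (chart_nonzerodivisor char_k (f := f)).
    exact: pow_plus_is_ideal.
  by move=> g; apply: pow_plus_stable DF _ _.
have : ideal_gen (eq v) (germ F q 'X_i).
  by apply/vE; exact: ideal_gen_incl.
apply: (@ideal_gen_min _ _ (fun x => exists w, x = w * v)) => [|_ <-];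
  last by exists 1; rewrite mul1r.
split=> [|x y [a ->] [b ->]|b x [a ->]].
- by exists 0; rewrite mul0r.
- by exists (a + b); rewrite mulrDl.
by exists (b * a); rewrite mulrA.
Qed.
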